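(* Let $\mathcal F$ be a finite family of connected bounded sets in $\mathbb R^2$ that are either all open or all compact, and let $n\le m$ be positive integers. Suppose that every subfamily $\mathcal G\subseteq\mathcal F$ with cardinality $|\mathcal G|\le m+1$ can be cut either by $m$ horizontal lines or by $n$ vertical lines. Then $\mathcal F$ can be cut by a family consisting of $m$ horizontal and $n$ vertical lines.
   Context: A family $\mathcal L$ of lines in $\mathbb R^2$ cuts a family $\mathcal F$ of subsets of $\mathbb R^2$ if for every $F\in\mathcal F$ there is some $l\in\mathcal L$ with $F\cap l\neq\emptyset$. A coordinate system in $\mathbb R^2$ is fixed; a line is horizontal if it is parallel to the $x$ axis and vertical if it is parallel to the $y$ axis. *)

(* Defs.v *)
(* MathComp-Analysis; the plane is [R * R] for an abstract [R : realType]. *)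
From mathcomp Require Import all_boot all_order all_algebra.
From mathcomp Require Import all_classical all_reals all_analysis.
Set Implicit Arguments.
Unset Strict Implicit.
Unset Printing Implicit Defensive.
Import Order.TTheory GRing.Theory Num.Theory.
Import numFieldNormedType.Exports.
Local Open Scope classical_set_scope.
Local Open Scope card_scope.
Local Open Scope ring_scope.

Definition line_through (R : realType) (p v : R * R) : set (R * R) :=
  [set p + (t * v.1, t * v.2) | t in [set: R]].

(* Both sets are lines with a common direction [v]; a line counts as parallel
   to itself, so the axes are themselves horizontal resp. vertical. *)
Definition parallel (R : realType) (l l' : set (R * R)) : Prop :=
  exists p q v : R * R,
    [/\ v != 0, l = line_through p v & l' = line_through q v].

Definition x_axis (R : realType) : set (R * R) := [set p | p.2 = 0].
Definition y_axis (R : realType) : set (R * R) := [set p | p.1 = 0].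

Definition horizontal (R : realType) (l : set (R * R)) : Prop :=
  parallel l (@x_axis R).

Definition vertical (R : realType) (l : set (R * R)) : Prop :=
  parallel l (@y_axis R).

Definition cuts (R : realType) (L F : set (set (R * R))) : Prop :=
  forall A, F A -> exists2 l, L l & A `&` l !=set0.

(* A set of exactly [k] distinct horizontal lines. *)
Definition horizontal_lines (R : realType) (k : nat) (L : set (set (R * R))) :
    Prop :=
  L #= `I_k /\ (forall l, L l -> horizontal l).

Definition vertical_lines (R : realType) (k : nat) (L : set (set (R * R))) :
    Prop :=
  L #= `I_k /\ (forall l, L l -> vertical l).

(* Main.v *)
(* Replace each set by the pair of its axis projections, which are intervals,
   and round these to integer intervals by means of one representative point
   for each intersecting pair; openness, compactness and boundedness then play
   no role.

   An integer point z of a dilated simplex with (m+1) + (n+1) coordinates gives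
   the widths of m+1 horizontal and n+1 vertical strips, hence m + n cuts. Every
   box t has a weight in cell (i, j), measuring how deep it lies inside that
   cell. Colour z by a row or a column of at most average weight, a row if the
   rows are the narrower side. The "No bullying" lemma of Petri and Voorneveld, a
   Sperner-type theorem with a parity proof, finds a small cluster J of points
   which are small in every coordinate that is not a colour of J. At any z in J
   every row and every column then has at most its fair share of the weight up
   to an error: either it is the colour of a nearby point, or its strip is too
   narrow to contain a box. If some box is missed by the cuts at z, the total
   weight dominates the error, and Hall's theorem yields m+1 boxes, one in
   each row, n+1 of which lie in distinct columns. No m horizontal and no
   n vertical lines cut these m+1 boxes. *)
From mathcomp Require Import all_boot zify.
Set Implicit Arguments.
Unset Strict Implicit.
Unset Printing Implicit Defensive.

(** * The no-bullying lemma *)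

Section Bullying.
Variables (X L : finType) (v : L -> X -> nat) (c : X -> L).
Hypothesis v_inj : forall l, injective (v l).
Implicit Types (J : {set X}) (I : {set L}).

(** A bully would be an [x] that beats, for every index in [I], the least element of [J]. All of [X]
    is searched for bullies, including [J] itself. *)
Definition unbullied J I :=
  [forall x, exists l in I, forall j in J, v l x <= v l j].

Lemma unbulliedP J I :
  reflect (forall x, exists2 l, l \in I & forall j, j \in J -> v l x <= v l j)
          (unbullied J I).
Proof.
apply: (iffP forallP) => H x.
  have /exists_inP[l lI /forall_inP h] := H x; by exists l.
by have [l lI h] := H x; apply/exists_inP; exists l => //; apply/forall_inP.
Qed.

Lemma unbullied_sub J J' I I' :
  J' \subset J -> I \subset I' -> unbullied J I -> unbullied J' I'.
Proof.
move=> /subsetP sJ /subsetP sI /unbulliedP H; apply/unbulliedP => x.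
by have [l lI h] := H x; exists l; [apply: sI | move=> j /sJ; apply: h].
Qed.

Definition worst J l j := (j \in J) && [forall k in J, v l j <= v l k].

Lemma worstP J l j :
  reflect (j \in J /\ forall k, k \in J -> v l j <= v l k) (worst J l j).
Proof.
by apply: (iffP andP) => -[jJ h]; split=> //; [move=> k kJ; apply: (forall_inP h)
  | apply/forall_inP].
Qed.

Lemma worst_uniq J l j k : worst J l j -> worst J l k -> j = k.
Proof.
move=> /worstP[jJ hj] /worstP[kJ hk]; apply: (@v_inj l).
by apply/eqP; rewrite eqn_leq hj // hk.
Qed.

Lemma worst_ex J l : J != set0 -> exists j, worst J l j.
Proof.
case/set0Pn=> j0 j0J; case: (arg_minnP (v l) j0J) => j jJ h.
by exists j; apply/worstP.
Qed.

Lemma unbullied_worst J I j :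
  unbullied J I -> j \in J -> exists2 l, l \in I & worst J l j.
Proof.
move=> /unbulliedP /(_ j)[l lI h] jJ; exists l => //; exact/worstP.
Qed.

(** Each element of [J] is worst for some index of [I]. If [l] and [l'] shared a worst element,
    [I :\ l] would still map onto [J], which is too large for that. *)
Lemma unbullied_worst_inj J I j l l' : unbullied J I -> #|I| <= #|J| ->
  l \in I -> l' \in I -> worst J l j -> worst J l' j -> l = l'.
Proof.
move=> dom le lI l'I wl wl'; apply/eqP/negPn/negP => ll'.
have J0 : J != set0 by apply/set0Pn; exists j; case/worstP: wl.
pose w l := odflt j [pick k | worst J l k].
have wP k : worst J k (w k).
  rewrite /w; case: pickP => //= h; have [x] := worst_ex k J0; by rewrite h.
have : J \subset w @: (I :\ l).
  apply/subsetP=> k kJ; have [i iI wi] := unbullied_worst dom kJ.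
  case: (eqVneq i l) => [il|il].
    rewrite (worst_uniq wi (_ : worst J i j)) ?il //.
    apply/imsetP; exists l'; first by rewrite !inE eq_sym ll'.
    exact: worst_uniq wl' (wP _).
  by apply/imsetP; exists i; [rewrite !inE il | apply: worst_uniq wi (wP _)].
move/subset_leq_card/leq_trans/(_ (leq_imset_card _ _)).
by have := cardsD1 l I; rewrite lI; lia.
Qed.

(* Rooms and doors are the vertices and edges of a graph in which every door
   leads to two rooms, except for the entrance [(set0, [set o])], and every room
   [(J, I)] has zero or two doors unless [c @: J = I]. *)
Definition room (r : {set X} * {set L}) := unbullied r.1 r.2 && (#|r.1| == #|r.2|).
Definition door (o : L) (d : {set X} * {set L}) :=
  [&& unbullied d.1 d.2, o \in d.2, #|d.1|.+1 == #|d.2| & c @: d.1 == d.2 :\ o].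
Definition incident (r d : {set X} * {set L}) :=
  (r.2 == d.2) && (d.1 \subset r.1) || (r.1 == d.1) && (r.2 \subset d.2).

(* Exactly two indices [l1], [l2] of a door share their worst element. A room
   behind the door drops one of them or, if that makes [J] bullied, keeps it and
   adds to [J] the bully that is best for it. *)
Lemma door_rooms o d : door o d -> d.1 != set0 ->
  #|[pred r | room r && incident r d]| = 2.
Proof.
case: d => J I /= /and4P[/= dom oI /eqP card _] J0.
pose w l := xchoose (worst_ex l J0).
have wP l : worst J l (w l) by apply: xchooseP.
have wJ l : w l \in J by case/worstP: (wP l).
have [l1 [l2 [l1I l2I l12 w12]]] : exists l1 l2, [/\ l1 \in I, l2 \in I, l1 != l2 & w l1 = w l2].
  (* Otherwise [w] would embed [I] into the smaller set [J]. *)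
  have : ~~ [forall l1 in I, forall l2 in I, (w l1 == w l2) ==> (l1 == l2)].
    apply/negP => /forall_inP H.
    have inj : {in I &, injective w}.
      move=> x y xI yI wxy; move/forall_inP: (H _ xI) => /(_ _ yI) /implyP.
      by rewrite wxy eqxx => /(_ isT) /eqP.
    have := card_in_imset inj.
    have /subset_leq_card : w @: I \subset J by apply/subsetP=> _ /imsetP[x _ ->].
    lia.
  rewrite negb_forall_in => /exists_inP[l1 l1I]; rewrite negb_forall_in.
  by move=> /exists_inP[l2 l2I]; rewrite negb_imply => /andP[/eqP ? ?]; exists l1, l2.
(* In the second form [x] takes over as worst element for [l] and for no other index of [I]. *)
pose toR l (r : {set X} * {set L}) :=
  r = (J, I :\ l) \/
  exists2 x, x \notin J & r = (x |: J, I) /\ forall k, k \in I -> (v k x < v k (w k)) = (k == l).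
have exits l : l = l1 \/ l = l2 ->
   exists2 r, room r && incident r (J, I) &
     toR l r /\ (forall r', room r' && incident r' (J, I) -> toR l r' -> r' = r).
  move=> ll.
  have lI : l \in I by case: ll => ->.
  have notw x : x \notin J -> forall k, v k x != v k (w k).
    move=> xJ k; apply: contraNneq xJ => /v_inj ->; exact: wJ.
  case: (boolP (unbullied J (I :\ l))) => [dom'|ndom].
    exists (J, I :\ l).
      rewrite /room /incident /= dom' eqxx subsetDl orbT andbT /=.
      by have := cardsD1 l I; rewrite lI -card => -[->].
    split; first by left.
    move=> r _ [//|[x xJ [-> h]]]; exfalso.
    have /unbulliedP /(_ x) [k] := dom'; rewrite !inE => /andP[kl kI] /(_ _ (wJ k)).
    by rewrite leq_eqVlt (negbTE (notw x xJ k)) h // (negbTE kl).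
  have [y0 y0P] : exists y, [pred y | [forall k in I :\ l, v k (w k) < v k y]] y.
    move: ndom; rewrite negb_forall => /existsP[y]; rewrite negb_exists => /forallP h.
    exists y; apply/forall_inP => k kI; move: (h k).
    rewrite kI /= negb_forall_in => /exists_inP[j jJ]; rewrite -ltnNge.
    by apply: leq_ltn_trans; case/worstP: (wP k) => _; apply.
  case: (arg_maxnP (v l) y0P) => x /forall_inP xP xmax.
  (* An element of [J] is worst for some index. Here this could only be [l], hence also the other of
     [l1] and [l2], where [x] beats the worst element. *)
  have xJ : x \notin J.
    apply/negP => xJ; pose l' := if l == l1 then l2 else l1.
    have [l'I l'l] : l' \in I :\ l /\ w l' = w l.
      rewrite /l' !inE; case: ll => ->.
        by rewrite eqxx eq_sym l12.
      by rewrite [l2 == l1]eq_sym (negbTE l12) l12.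
    have [k kI wk] := unbullied_worst dom xJ.
    have ek : w k = x by apply: worst_uniq wk.
    case: (eqVneq k l) => [kl|kl].
      by have := xP _ l'I; rewrite l'l -kl ek ltnn.
    by have := xP k; rewrite !inE kl kI ek ltnn => /(_ isT).
  have xl' k : k \in I -> k != l -> v k (w k) < v k x.
    by move=> kI kl; apply: xP; rewrite !inE kl.
  have xl : v l x < v l (w l).
    have /unbulliedP /(_ x) [k kI /(_ _ (wJ k))] := dom.
    case: (eqVneq k l) => [->|kl]; first by rewrite ltn_neqAle notw.
    by rewrite leqNgt xl'.
  have xk k : k \in I -> (v k x < v k (w k)) = (k == l).
    move=> kI; case: (eqVneq k l) => [->|kl]; first by rewrite xl.
    by rewrite ltnNge ltnW ?xl'.
  exists (x |: J, I).
    rewrite /room /incident /= eqxx subsetUr /= andbT cardsU1 xJ add1n card eqxx andbT.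
    apply/unbulliedP => y.
    (* If [y] bullies [J] on [I :\ l], the maximality of [x] stops it at [l]; otherwise an index
       other than [l] already does. *)
    case: (boolP [forall k in I :\ l, v k (w k) < v k y]) => [yP|].
      exists l => // j; have := xmax _ yP; rewrite !inE => yx /orP[/eqP -> //|jJ].
      by have /worstP[_ /(_ _ jJ)] := wP l; apply/leq_trans/(leq_trans yx)/ltnW.
    rewrite negb_forall_in => /exists_inP[k]; rewrite -leqNgt inE inE => /andP[kl kI] yk.
    exists k => // j; rewrite !inE => /orP[/eqP ->|jJ].
      by apply: leq_trans yk _; apply/ltnW/xl'.
    by have /worstP[_ /(_ _ jJ)] := wP k; apply: leq_trans.
  split; first by right; exists x.
  move=> r /andP[rr _] [re|[x' x'J [re h]]].
    by case/negP: ndom; case/andP: rr; rewrite re.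
  have : v l x = v l x'; last by move/v_inj ->.
  have x'P : [pred y | [forall k in I :\ l, v k (w k) < v k y]] x'.
    apply/forall_inP => k; rewrite !inE => /andP[kl kI].
    by rewrite ltn_neqAle eq_sym notw // leqNgt h // (negbTE kl).
  apply/eqP; rewrite eqn_leq; have := xmax _ x'P; rewrite /= => ->; rewrite andbT.
  move: rr; rewrite re => /andP[/= /unbulliedP /(_ x)[k kI kh] _].
  case: (eqVneq k l) => [<-|kl]; first by apply: kh; rewrite !inE eqxx.
  have := kh (w k); rewrite !inE wJ orbT => /(_ isT).
  by rewrite leqNgt xl'.
have [r1 r1P [t1 u1]] := exits l1 (or_introl erefl).
have [r2 r2P [t2 u2]] := exits l2 (or_intror erefl).
have r12 : r1 != r2.
  apply: contraTneq l12 => r12; rewrite r12 in t1; rewrite negbK.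
  case: t1 t2 => [->|[x xJ [-> h]]] [|[x' x'J []]].
  - case=> /setP /(_ l2); rewrite !inE eqxx l2I andbT eq_sym /=.
    by move/negbT; rewrite negbK.
  - by case=> JJ; move: x'J; rewrite {1}JJ !inE eqxx.
  - by case=> JJ; move: xJ; rewrite -{1}JJ !inE eqxx.
  case=> /setP /(_ x); rewrite !inE eqxx (negbTE xJ) !orbF => /esym/idP/eqP <- h'.
  by rewrite -(h' _ l1I) (h _ l1I) eqxx.
(* Removing a third index would keep both [l1] and [l2], and with them the coincidence. *)
have critical l : l \in I ->
    (forall k k', k \in I -> k' \in I -> k != l -> k' != l -> w k = w k' -> k = k') ->
    l = l1 \/ l = l2.
  move=> lI h; case: (eqVneq l l1) => [|n1]; first by left.
  case: (eqVneq l l2) => [|n2]; first by right.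
  by case/eqP: l12; apply: h => //; rewrite eq_sym.
rewrite -(_ : #|pred2 r1 r2| = 2); last by rewrite card2 r12.
apply: eq_card => r; rewrite [LHS]inE [RHS]inE.
apply/idP/idP; last by case/orP=> /eqP ->.
case: r => J' I' rP; have /andP[/andP[/= dom' /eqP card'] inc] := rP.
suff [l ll t] : exists2 l, l = l1 \/ l = l2 & toR l (J', I').
  by case: ll t => -> t; rewrite ?(u1 _ rP t) ?(u2 _ rP t) eqxx ?orbT.
clear rP; move: inc.
rewrite /incident /= => /orP[/andP[/eqP E sJ]|/andP[/eqP E sI]]; subst.
  have /cards1P[x xE] : #|J' :\: J| == 1.
    by rewrite cardsD (setIidPr sJ) card' -card subSnn.
  have : x \in J' :\: J by rewrite xE inE.
  rewrite inE => /andP[xJ xJ'].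
  have J'E : J' = x |: J by rewrite -(setID J' J) (setIidPr sJ) xE setUC.
  (* In a room [x] is worst for one index only. The others keep their distinct worst elements, so
     [l] is critical. *)
  have [l lI lx] := unbullied_worst dom' xJ'.
  have wn k : k \in I -> k != l -> v k (w k) < v k x.
    move=> kI; apply: contraNltn => le; apply/eqP.
    apply: (unbullied_worst_inj dom' _ kI lI _ lx); first by rewrite card'.
    apply/worstP; split=> // j; rewrite J'E !inE => /orP[/eqP ->//|jJ].
    by have /worstP[_ /(_ _ jJ)] := wP k; apply: leq_trans.
  have ww k : k \in I -> k != l -> worst J' k (w k).
    move=> kI kl; apply/worstP; split; first by rewrite J'E !inE wJ orbT.
    move=> j; rewrite J'E !inE => /orP[/eqP ->|jJ]; first exact/ltnW/wn.
    by have /worstP[_ /(_ _ jJ)] := wP k.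
  exists l.
    apply: critical => // k k' kI k'I kl k'l ek.
    apply: (unbullied_worst_inj dom' _ kI k'I (ww _ kI kl)); first by rewrite card'.
    by rewrite ek; apply: ww.
  right; exists x; rewrite ?J'E //; split=> // k kI.
  case: (eqVneq k l) => [->|kl]; last by rewrite ltnNge ltnW ?wn.
  have /worstP[_ /(_ (w l))] := lx; rewrite J'E !inE wJ orbT => /(_ isT) le.
  by rewrite ltn_neqAle le andbT; apply: contraNneq xJ => /v_inj ->; apply: wJ.
have /cards1P[l lE] : #|I :\: I'| == 1.
  by rewrite cardsD (setIidPr sI) -card' -card subSnn.
have : l \in I :\: I' by rewrite lE inE.
rewrite inE => /andP[lI' lI].
have I'E : I' = I :\ l by rewrite -lE setDDr setDv set0U (setIidPr sI).
exists l; last by left; rewrite I'E.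
apply: critical => // k k' kI k'I kl k'l ek.
apply: (unbullied_worst_inj dom' _ _ _ (wP k)); rewrite ?card' ?I'E ?inE ?kl ?k'l //.
by rewrite ek.
Qed.

(** A door deletes some [j] from [J] or adds some [i] to [I], and the second kind entails one of the
    first. Given a deletable [j], either its colour recurs at exactly one other [j'], which is then
    the only other deletable element, or its colour is new and adding it to [I] gives the only other
    door. *)
Lemma room_doors o r : room r -> c @: r.1 != r.2 ->
  ~~ odd #|[pred d | door o d && incident r d]|.
Proof.
case: r => J I /= /andP[/= dom /eqP card] cJI.
have card_c j : j \in J -> c @: (J :\ j) = I :\ o -> o \in I ->
    {in J :\ j &, injective c}.
  move=> jJ cJ oI; apply/imset_injP; rewrite cJ.
  by rewrite -(eqn_add2l (j \in J)) -cardsD1 jJ -oI -cardsD1 card.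
pose doorA j := [&& j \in J, o \in I & c @: (J :\ j) == I :\ o].
pose doorB i := [&& i \notin I, o \in I & c @: J == i |: (I :\ o)].
have doorAP j : doorA j -> door o (J :\ j, I) && incident (J, I) (J :\ j, I).
  move=> /and3P[jJ oI cJ]; rewrite /door /incident /= oI cJ eqxx subsetDl /= !andbT.
  rewrite (unbullied_sub _ _ dom) ?subsetDl //= -card.
  by rewrite (cardsD1 j J) jJ.
have doorBP i : doorB i -> door o (J, i |: I) && incident (J, I) (J, i |: I).
  move=> /and3P[iI oI /eqP cJ].
  rewrite /door /incident /= !inE oI eqxx subsetUr !orbT /= ?andbT.
  rewrite (unbullied_sub _ _ dom) ?subsetUr //= cardsU1 iI card eqxx /= cJ.
  rewrite setDUl; apply/eqP; congr (_ :|: _); apply/esym/setDidPl.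
  by rewrite disjoints1 inE; apply: contraNneq iI => ->.
have doorE d : door o d && incident (J, I) d ->
    (exists2 j, doorA j & d = (J :\ j, I)) \/ (exists2 i, doorB i & d = (J, i |: I)).
  case: d => J' I' /andP[/and4P[/= dom' oI' /eqP card' /eqP cJ']].
  rewrite /incident /= => /orP[/andP[/eqP E sJ]|/andP[/eqP E sI]]; subst.
    left; have /cards1P[x xE] : #|J :\: J'| == 1.
      by rewrite cardsD (setIidPr sJ) card -card' subSnn.
    have J'E : J' = J :\ x by rewrite -xE setDDr setDv set0U (setIidPr sJ).
    have : x \in J :\: J' by rewrite xE inE.
    rewrite inE => /andP[_ xJ].
    by exists x; rewrite /doorA -J'E ?xJ ?oI' ?cJ' ?eqxx.
  right; have /cards1P[i iE] : #|I' :\: I| == 1.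
    by rewrite cardsD (setIidPr sI) -card' card subSnn.
  have : i \in I' :\: I by rewrite iE inE.
  rewrite inE => /andP[iI iI'].
  have I'E : I' = i |: I by rewrite -iE setUC -{1}(setIidPr sI) setID.
  exists i; last by rewrite I'E.
  have oi : i != o.
    apply: contraNneq cJI => io; rewrite cJ' I'E io setDUl setDv set0U.
    by apply/eqP/setDidPl; rewrite disjoint_sym disjoints1 -io.
  have oI : o \in I by move: oI'; rewrite I'E !inE eq_sym (negbTE oi).
  rewrite /doorB iI oI cJ' I'E setDUl; apply/eqP; congr (_ :|: _).
  by apply/setDidPl; rewrite disjoints1 inE.
have doorBA i : doorB i -> exists j, doorA j /\ c j = i.
  move=> /and3P[iI oI /eqP cJ].
  have inj : {in J &, injective c}.
    apply/imset_injP; rewrite cJ cardsU1 !inE (negbTE iI) andbF /= card.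
    by rewrite [eqbRHS](cardsD1 o I) oI.
  have /imsetP[j jJ ij] : i \in c @: J by rewrite cJ !inE eqxx.
  exists j; split=> //; rewrite /doorA jJ oI /=; apply/eqP/setP => k.
  apply/imsetP/idP => [[x]|kI].
    rewrite !inE => /andP[xj xJ] ->; have : c x \in c @: J by apply: imset_f.
    by rewrite cJ !inE ij => /orP[/eqP /inj|//]; move=> /(_ xJ jJ) /eqP; rewrite (negbTE xj).
  have /imsetP[x xJ kx] : k \in c @: J by rewrite cJ inE kI orbT.
  exists x => //; rewrite !inE xJ andbT; apply: contraNneq iI => xj.
  by move: kI; rewrite inE kx xj -ij => /andP[_].
have doorA2 j : doorA j -> exists2 d1, d1 != (J :\ j, I) &
    [pred d | door o d && incident (J, I) d] =i pred2 (J :\ j, I) d1.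
  move=> dA; have /and3P[jJ oI /eqP cJ] := dA.
  have inj := card_c j jJ cJ oI.
  have cJU : c @: J = c j |: (I :\ o) by rewrite -(setD1K jJ) imsetU1 cJ.
  case: (boolP (c j \in I :\ o)) => cj.
    have /imsetP[j' j'J cj'] : c j \in c @: (J :\ j) by rewrite cJ.
    have jj' : j != j' by move: j'J; rewrite !inE eq_sym => /andP[].
    have j'J' : j' \in J by move: j'J; rewrite inE => /andP[].
    have cJ2 : c @: J = I :\ o.
      by rewrite cJU; apply/setUidPr; rewrite sub1set.
    have dA' : doorA j'.
      rewrite /doorA j'J' oI /= -cJ2; apply/eqP/setP => k; apply/imsetP/imsetP => -[x].
        by rewrite inE => /andP[_ xJ] ->; exists x.
      move=> xJ ->; case: (eqVneq x j') => [->|xj].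
        by exists j => //; rewrite !inE jj'.
      by exists x => //; rewrite !inE xj.
    exists (J :\ j', I).
      apply: contraNneq jj' => -[/setP /(_ j)]; rewrite !inE eqxx jJ andbT.
      by move/negbFE.
    move=> d; rewrite [LHS]inE [RHS]inE; apply/idP/idP; last first.
      by case/orP => /eqP ->; apply: doorAP.
    case/doorE => [[x dx ->]|[i /and3P[iI _ /eqP ci] _]]; last first.
      by move: iI; have : i \in I :\ o; [rewrite -cJ2 ci !inE eqxx | rewrite inE => /andP[_ ->]].
    case: (eqVneq x j) => [->|xj]; first by rewrite eqxx.
    case: (eqVneq x j') => [->|xj']; first by rewrite eqxx orbT.
    have /and3P[xJ _ /eqP cx] := dx.
    have := card_c x xJ cx oI j j'; rewrite !inE jJ j'J' !(eq_sym _ x) xj xj'.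
    by move=> /(_ isT isT cj') /eqP; rewrite (negbTE jj').
  have cjo : c j != o.
    apply: contraNneq cJI => co; rewrite cJU co; apply/eqP; exact: setD1K.
  have cjI : c j \notin I by move: cj; rewrite inE inE cjo.
  exists (J, c j |: I).
    by apply/eqP=> -[/setP /(_ j)]; rewrite !inE eqxx jJ.
  move=> d; rewrite [LHS]inE [RHS]inE; apply/idP/idP; last first.
    by case/orP => /eqP ->; [apply: doorAP | apply: doorBP; rewrite /doorB cjI oI cJU eqxx].
  case/doorE => [[x /and3P[xJ _ /eqP cx] ->]|[i /and3P[iI _ /eqP ci] ->]].
    case: (eqVneq x j) => [->|xj]; first by rewrite eqxx.
    case/negP: cj; rewrite -cx; apply: imset_f; by rewrite !inE eq_sym xj.
  have : c j \in i |: (I :\ o) by rewrite -ci imset_f.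
  by rewrite in_setU1 (negbTE cj) orbF => /eqP ->; rewrite eqxx orbT.
case: (pickP [pred d | door o d && incident (J, I) d]) => [d|h]; last by rewrite eq_card0.
have : forall j, doorA j -> ~~ odd #|[pred d | door o d && incident (J, I) d]|.
  by move=> j /doorA2[d1 d1j /eq_card ->]; rewrite card2 eq_sym d1j.
move=> H; case/doorE => [[j /H //]|[i /doorBA[j [/H //]]]].
Qed.

(** Incidences are counted twice. If no room had [c @: J = I], the count by rooms would be even; the
    count by doors is odd, as the entrance has one room and every other door two. *)
Theorem no_bullying (x0 : X) : exists2 J : {set X}, J != set0 &
  forall x, exists2 l, l \in c @: J & forall j, j \in J -> v l x <= v l j.
Proof.
pose o := c x0.
suff /existsP[[J I]] : [exists r : {set X} * {set L}, room r && (c @: r.1 == r.2)].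
  move=> /= /andP[/andP[/= /unbulliedP dom /eqP card] /eqP cJ]; exists J.
    apply/eqP=> J0; have [l] := dom x0.
    by rewrite -cJ J0 imset0 inE.
  by rewrite cJ.
apply: contraT; rewrite negb_exists => /forallP norm.
have even : ~~ odd (\sum_(r | room r) #|[pred d | door o d && incident r d]|).
  apply: (big_ind (fun n => ~~ odd n)) => // [a b|r rr].
    by rewrite oddD => /negbTE -> /negbTE ->.
  by apply: room_doors => //; move: (norm r); rewrite rr.
case/negP: even.
have -> : \sum_(r | room r) #|[pred d | door o d && incident r d]| =
          \sum_(d | door o d) #|[pred r | room r && incident r d]|.
  transitivity (\sum_(r | room r) \sum_(d | door o d) incident r d).
    apply: eq_bigr => r _; rewrite -sum1_card [RHS]big_mkcond [LHS]big_mkcond /=.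
    by apply: eq_bigr => d _; rewrite inE; case: (door o d); case: incident.
  rewrite exchange_big /=; apply: eq_bigr => d _.
  rewrite -sum1_card [RHS]big_mkcond [LHS]big_mkcond /=.
  by apply: eq_bigr => r _; rewrite inE; case: (room r); case: incident.
have door0 : door o (set0, [set o]).
  rewrite /door /= !inE eqxx cards0 cards1 imset0 setDv !eqxx /= ?andbT.
  by apply/unbulliedP => x; exists o; rewrite ?inE // => j; rewrite inE.
rewrite (bigD1 _ door0) /=.
have -> : #|[pred r | room r && incident r (set0, [set o])]| = 1.
  have [m /worstP[_ hm]] : exists m, worst [set: X] o m.
    by apply: worst_ex; apply/set0Pn; exists x0; rewrite inE.
  have [a _ amax] := arg_maxnP (v o) (erefl true : predT x0).
  (* The entrance opens only into the room of the top element [a] for [o]. *)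
  apply: (@eq_card1 _ ([set a], [set o])) => -[J I]; rewrite [LHS]inE [RHS]inE.
  apply/idP/eqP => [/andP[/andP[/= dom /eqP card]]|[-> ->]]; last first.
    rewrite /room /incident /= !cards1 !eqxx sub0set /= ?andbT.
    by apply/unbulliedP => x; exists o; rewrite ?inE // => j; rewrite inE => /eqP ->; apply: amax.
  rewrite /incident /= sub0set andbT => /orP[/eqP Io|/andP[/eqP J0 _]]; last first.
    move/unbulliedP: dom => /(_ x0)[l].
    by move/eqP: card; rewrite J0 cards0 eq_sym cards_eq0 => /eqP ->; rewrite inE.
  move: card; rewrite Io cards1 => /eqP/cards1P[x Jx]; rewrite Jx; congr ([set _], _).
  subst; move/unbulliedP: dom => /(_ a)[l]; rewrite inE => /eqP -> /(_ x).
  rewrite inE eqxx => /(_ isT) le; apply: (@v_inj o); apply/eqP.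
  by rewrite eqn_leq le andbT; apply: amax.
rewrite addnC addn1 oddS; apply: (big_ind (fun n => ~~ odd n)) => // [a b|d /andP[dd dn]].
  by rewrite oddD => /negbTE -> /negbTE ->.
(* With [J] empty, [I] is a singleton containing [o]: only the entrance is like that. *)
rewrite (door_rooms dd) //; apply: contraNneq dn => d0.
case: d dd d0 => J I /and4P[/= _ oI /eqP card _] J0; rewrite J0 cards0 in card *.
by rewrite xpair_eqE eqxx eq_sym eqEcard sub1set oI -card cards1.
Qed.

End Bullying.

(** * Hall's theorem *)

Section Hall.
Variables A B : finType.
Implicit Types (E : {set A * B}) (S : {set A}).

Definition neighbours E S := [set b | [exists a in S, (a, b) \in E]].

Lemma neighboursP E S b :
  reflect (exists2 a, a \in S & (a, b) \in E) (b \in neighbours E S).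
Proof. by rewrite inE; apply: exists_inP. Qed.

Definition hall E := forall S, #|S| <= #|neighbours E S|.

Lemma hall_inj E (g : A -> B) : hall E ->
  (forall a b, (a, b) \in E -> b = g a) -> injective g.
Proof.
move=> hE uniqE x y gxy; apply/eqP; apply: contraT => xy.
have := hE [set x; y]; rewrite cards2 xy /= leqNgt ltnS => /negP; case.
rewrite -(cards1 (g x)); apply/subset_leq_card/subsetP => b /neighboursP[a].
by rewrite !inE => /orP[] /eqP -> /uniqE ->; rewrite ?gxy.
Qed.

(* Rado's proof: in an edge-minimal graph satisfying Hall's condition, no
   vertex of [A] has degree two. *)
Theorem hall_marriage E : hall E ->
  exists2 g : A -> B, injective g & forall a, (a, g a) \in E.
Proof.
move: {2}#|E| (leqnn #|E|) => k; elim: k E => [|k IHk] E cE hE.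
all: have nE a : exists b, (a, b) \in E.
1,3: have := hE [set a]; rewrite cards1 card_gt0 => /set0Pn[b /neighboursP[a']];
  by rewrite inE => /eqP ->; exists b.
- move: cE; rewrite leqn0 cards_eq0 => /eqP E0.
  have noA (a : A) : False by have [b] := nE a; rewrite E0 inE.
  by exists (fun a => False_rect B (noA a)) => a; case: (noA a).
case: (boolP [forall p in E, forall q in E, (p.1 == q.1) ==> (p.2 == q.2)]).
  move=> /forall_inP uE; have [g gE] : exists g : A -> B, forall a, (a, g a) \in E.
    by exists (fun a => xchoose (nE a)) => a; apply: (xchooseP (nE a)).
  exists g => //; apply: (hall_inj hE) => a b abE.
  move/forall_inP: (uE _ abE) => /(_ _ (gE a)) /implyP; rewrite eqxx.
  by move=> /(_ isT) /eqP.
rewrite negb_forall_in => /exists_inP[[a b1] e1]; rewrite negb_forall_in.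
move=> /exists_inP[[a' b2] e2]; rewrite negb_imply /= => /andP[/eqP eaa b12].
subst a'.
have step b : (a, b) \in E -> (exists2 g : A -> B, injective g & forall x, (x, g x) \in E) \/
    exists2 S : {set A}, a \in S & #|neighbours (E :\ (a, b)) S| < #|S|.
  move=> ebE; case: (boolP [forall S : {set A}, #|S| <= #|neighbours (E :\ (a, b)) S|]).
    move/forallP/IHk => -[|g gi gE]; first by move: cE; rewrite (cardsD1 (a, b)) ebE.
    by left; exists g => // x; have := gE x; rewrite inE => /andP[].
  rewrite negb_forall => /existsP[S]; rewrite -ltnNge => lt; right; exists S => //.
  apply: contraLR lt => aS; rewrite -leqNgt; apply: leq_trans (hE S) _.
  apply/subset_leq_card/subsetP => y /neighboursP[x xS xy]; apply/neighboursP.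
  exists x => //; rewrite !inE xy andbT xpair_eqE.
  by apply: contraNN aS => /andP[/eqP <-].
case: (step b1 e1) => // -[S1 aS1 lt1]; case: (step b2 e2) => // -[S2 aS2 lt2].
set N1 := neighbours _ S1 in lt1; set N2 := neighbours _ S2 in lt2.
(* An edge deleted from one graph survives in the other, so the union loses no neighbours; the
   intersection is taken without [a]. The sum of both bounds contradicts [lt1] and [lt2]. *)
have cup : #|S1 :|: S2| <= #|N1 :|: N2|.
  apply: leq_trans (hE _) _; apply/subset_leq_card/subsetP => y /neighboursP[x xS xy].
  rewrite inE; case: (eqVneq x a) => [xa|xa].
    subst x; case: (eqVneq y b1) => [->|yb].
      apply/orP; right; apply/neighboursP; exists a => //.
      by rewrite !inE e1 xpair_eqE (negbTE b12) andbF.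
    apply/orP; left; apply/neighboursP; exists a => //.
    by rewrite !inE xy xpair_eqE (negbTE yb) andbF.
  by move: xS; rewrite inE => /orP[] xS; apply/orP; [left|right];
    apply/neighboursP; exists x => //; rewrite !inE xpair_eqE (negbTE xa).
have cap : #|(S1 :&: S2) :\ a| <= #|N1 :&: N2|.
  apply: leq_trans (hE _) _; apply/subset_leq_card/subsetP => y /neighboursP[x].
  rewrite !inE => /andP[xa /andP[x1 x2]] xy.
  by apply/andP; split; apply/exists_inP; exists x; rewrite // !inE xpair_eqE (negbTE xa).
have := cardsUI S1 S2; have := cardsUI N1 N2.
have := cardsD1 a (S1 :&: S2); rewrite inE aS1 aS2 /=.
by move: lt1 lt2 cup cap; clear; lia.
Qed.
End Hall.

(** * Matrices with nearly balanced row and column sums *)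

Lemma sum_le_const (I : finType) (P : pred I) (F : I -> nat) k :
  (forall i, P i -> F i <= k) -> \sum_(i | P i) F i <= #|P| * k.
Proof.
by move=> h; rewrite -sum_nat_const; apply: leq_sum.
Qed.

(** With an empty row, the other [m] rows could not carry the whole weight. If a set [S] of columns
    violated Hall's condition, all weight would lie in the few rows meeting [S] and in the columns
    outside [S], which is again too little. *)
Lemma balanced_matching (m n E W : nat) (M : 'I_m.+1 -> 'I_n.+1 -> nat) :
  n <= m -> W = \sum_i \sum_j M i j -> E * m.+1 < W ->
  (forall i, m.+1 * \sum_j M i j <= W + E) ->
  (forall j, n.+1 * \sum_i M i j <= W + E) ->
  (forall i, exists j, 0 < M i j) /\
  exists2 g : 'I_n.+1 -> 'I_m.+1, injective g & forall j, 0 < M (g j) j.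
Proof.
move=> nm WE EW row col; split.
  move=> i; apply/existsP; apply: contraT; rewrite negb_exists => /forallP h.
  have r0 : \sum_j M i j = 0 by apply: big1 => j _; have := h j; rewrite -eqn0Ngt => /eqP.
  have : m.+1 * W <= m * (W + E).
    rewrite {1}WE (bigD1 i) //= r0 add0n big_distrr /=.
    apply: leq_trans (sum_le_const (fun k _ => row k)) _.
    by rewrite cardC1 card_ord.
  by move: EW; clear; lia.
pose Ed := [set p : 'I_n.+1 * 'I_m.+1 | 0 < M p.2 p.1].
have [|g gi gE] := @hall_marriage _ _ Ed; last by exists g => // j; have := gE j; rewrite inE.
move=> S; rewrite leqNgt; apply/negP => lt.
set N := neighbours Ed S in lt.
have WU : W <= \sum_(i in N) \sum_j M i j + \sum_(j in ~: S) \sum_i M i j.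
  rewrite WE (bigID (mem N)) /= leq_add2l.
  rewrite [leqRHS]exchange_big /= [leqRHS](bigID (mem N)) /=.
  apply: leq_trans (leq_addl _ _); apply: leq_sum => i iN.
  rewrite (bigID (mem S)) /= big1 ?add0n.
    by apply: eq_leq; apply: eq_bigl => j; rewrite inE.
  move=> j jS; apply/eqP; rewrite eqn0Ngt; apply: contraNN iN => ij.
  by apply/neighboursP; exists j; rewrite ?inE.
have row' : m.+1 * \sum_(i in N) \sum_j M i j <= #|N| * (W + E).
  by rewrite big_distrr /=; apply: sum_le_const.
have col' : n.+1 * \sum_(j in ~: S) \sum_i M i j <= #|~: S| * (W + E).
  by rewrite big_distrr /=; apply: sum_le_const.
have := cardsC S; rewrite card_ord.
move: row' col' WU lt EW nm; clear.
move: (\sum_(i in N) _) (\sum_(j in ~: S) _) #|N| #|S| #|~: S| => x y a s t.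
move=> row col WU lt EW nm st.
have h1 : m.+1 * n.+1 * W <= (n.+1 * a + m.+1 * t) * (W + E).
  apply: (@leq_trans (m.+1 * n.+1 * (x + y))); first by rewrite leq_mul2l WU orbT.
  rewrite mulnDr mulnDl -!mulnA [m.+1 * (_ * x)]mulnCA.
  by rewrite leq_add // leq_mul2l ?row ?col orbT.
(* From [a < s] and [n <= m] follows [n.+1 * a.+1 <= m.+1 * s]. *)
have h2 : n.+1 * a + m.+1 * t + n.+1 <= m.+1 * n.+1.
  apply: (@leq_trans (m.+1 * s + m.+1 * t)); last by rewrite -mulnDr st.
  by rewrite addnAC -mulnSr leq_add2r leq_mul.
have h3 : n.+1 * W <= m.+1 * n.+1 * E.
  have := leq_mul h2 (leqnn (W + E)); rewrite mulnDl => h4.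
  move: h1 h4; rewrite !mulnDr.
  move: (_ * W) (_ * W) (_ * E) (_ * E) (_ * E); clear; lia.
by move: h3; rewrite leqNgt [m.+1 * _]mulnC -mulnA ltn_pmul2l // [m.+1 * _]mulnC EW.
Qed.

(** * Integer boxes *)

(** If the minima over [J] of the coordinates in [c @: J] fell short of [N] by [#|L|] or more,
    raising each by one would give a bully. So these minima nearly exhaust every point of [J], which
    bounds the differences of partial sums. *)
Lemma grid_bullying (L : finType) (N : nat) (l0 : L)
    (c : {ffun L -> 'I_N.+1} -> L) :
  exists J : {set {ffun L -> 'I_N.+1}}, [/\ J != set0,
    forall z, z \in J -> \sum_l z l = N,
    forall z, z \in J -> N < \sum_(l in c @: J) z l + #|L| &
    forall (z z' : {ffun L -> 'I_N.+1}) (A : pred L), z \in J -> z' \in J ->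
      \sum_(l | A l) z l <= \sum_(l | A l) z' l + #|L|].
Proof.
pose X := {z : {ffun L -> 'I_N.+1} | \sum_l z l == N}.
(* The rank breaks ties, making [v l] injective without reversing strict inequalities between
   coordinates. *)
pose v l (x : X) := val x l * #|{: X}| + enum_rank x.
have rank_lt (x : X) : enum_rank x < #|{: X}| by [].
have v_inj l : injective (v l).
  move=> x y /(congr1 (modn^~ #|{: X}|)); rewrite /v !modnMDl !modn_small //.
  by move/val_inj/enum_rank_inj.
have v_le l (x y : X) : v l x <= v l y -> val x l <= val y l.
  rewrite /v !(leqNgt (nat_of_ord _)) => le; apply/negP => lt; move: le.
  rewrite leqNgt => /negP; apply; have := rank_lt y.
  have : (val y l).+1 * #|{: X}| <= val x l * #|{: X}| by rewrite leq_mul2r lt orbT.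
  by rewrite mulSn; move: (_ * _) (_ * _) => p q; move: (nat_of_ord (enum_rank y)) => r; lia.
have mk (f : L -> nat) : \sum_l f l = N -> exists x : X, forall l, val x l = f l :> nat.
  move=> fN; have fl l : f l < N.+1 by rewrite ltnS -fN (bigD1 l) //= leq_addr.
  have gN : \sum_l [ffun l => Ordinal (fl l)] l == N.
    by rewrite -[X in _ == X]fN; apply/eqP/eq_bigr => l _; rewrite ffunE.
  by exists (Sub [ffun l => Ordinal (fl l)] gN) => l; rewrite SubK ffunE.
have [x0 _] : exists x : X, forall l, val x l = (if l == l0 then N else 0) :> nat.
  by apply: mk; rewrite -big_mkcond big_pred1_eq.
have [J0 J0n dom] := no_bullying (c \o val) v_inj x0.
have [y0 y0J] := set0Pn _ J0n.
pose worse l := [arg min_(y < y0 in J0) val y l].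
have worseJ l : worse l \in J0 by rewrite /worse; case: arg_minnP.
pose u l : nat := val (worse l) l.
have u_le l y : y \in J0 -> u l <= val y l.
  by rewrite /u /worse; case: arg_minnP => // k _ h /h.
set I := (c \o val) @: J0 in dom.
have I0 : 0 < #|I| by apply/card_gt0P; exists (c (val y0)); apply: imset_f.
have sumu : N < \sum_(l in I) u l + #|L|.
  apply: (@leq_trans (\sum_(l in I) (u l).+1)); last first.
    under eq_bigr do rewrite -addn1.
    by rewrite big_split /= leq_add2l sum1_card max_card.
  rewrite ltnNge; apply/negP => le.
  have [l1 l1I] := card_gt0P I0.
  (* The surplus goes to the arbitrary index [l1], so that the bully has coordinate sum [N]. *)
  pose f l := if l \in I then (u l).+1 + (l == l1) * (N - \sum_(l in I) (u l).+1) else 0.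
  have [|x xE] := mk f.
    rewrite -big_mkcond /= big_split /= -big_distrl /=.
    have -> : \sum_(l in I) (l == l1) = 1.
      by rewrite (bigD1 l1) //= eqxx big1 // => l /andP[_ /negbTE ->].
    by rewrite mul1n subnKC.
  have [l lI] := dom x; move=> /(_ _ (worseJ l)) /v_le.
  by rewrite xE /f lI addSn ltnNge leq_addr.
exists [set val y | y in J0].
have cJ : c @: [set val y | y in J0] = I by rewrite -imset_comp.
split.
- by apply/set0Pn; exists (val y0); apply: imset_f.
- by move=> _ /imsetP[y _ ->]; apply/eqP/(valP y).
- move=> _ /imsetP[y yJ ->]; rewrite cJ; apply: (leq_trans sumu).
  by rewrite leq_add2r; apply: leq_sum => l _; apply: u_le.
move=> _ _ A /imsetP[y yJ ->] /imsetP[y' y'J ->].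
have yN : \sum_l val y l = N by apply/eqP/(valP y).
pose B : pred L := fun l => A l && (l \in I).
have h1 : \sum_(l | B l) u l <= \sum_(l | A l) val y' l.
  rewrite [leqRHS](bigID (mem I)) /=; apply: (leq_trans _ (leq_addr _ _)).
  by apply: leq_sum => l _; apply: u_le.
have h2 : \sum_(l | A l) val y l + \sum_(l in I) u l <= N + \sum_(l | B l) u l.
  have -> : \sum_(l in I) u l = \sum_(l | B l) u l + \sum_(l in I | ~~ A l) u l.
    by rewrite (bigID A); congr (_ + _); apply: eq_bigl => l; rewrite andbC.
  rewrite addnCA addnC leq_add2r -[leqRHS]yN [leqRHS](bigID A) leq_add2l /=.
  rewrite [leqRHS](bigID (mem I)) /=; apply: leq_trans (leq_addr _ _).
  under eq_bigl do rewrite andbC.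
  by apply: leq_sum => l /andP[_ lI]; apply: u_le.
rewrite -(leq_add2r (\sum_(l in I) u l)) (leq_trans h2) //.
by rewrite -addnA [#|L| + _]addnC [leqRHS]addnC leq_add // ltnW.
Qed.

(** * Strips and the depth of intervals in them *)

Section Strips.
Variable k : nat.
Implicit Types (z : 'I_k.+1 -> nat) (i : 'I_k.+1).

(** Positions [0] and [k.+1] are the outer borders; the [k] positions between them are the actual
    cuts. *)
Definition cut z (i : nat) := \sum_(l < k.+1 | l < i) z l.

Lemma cut0 z : cut z 0 = 0.
Proof. exact: big_pred0. Qed.

Lemma cutS z i : cut z i.+1 = cut z i + z i.
Proof.
rewrite /cut (bigD1 i) //= addnC; congr (_ + _).
by apply: eq_bigl => l; rewrite ltnS [in RHS]ltn_neqAle andbC.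
Qed.

Lemma cut_last z : cut z k.+1 = \sum_i z i.
Proof. by apply: eq_bigl => l; rewrite ltn_ord. Qed.

Lemma cut_mono z (i j : nat) : i <= j -> cut z i <= cut z j.
Proof.
move=> ij; rewrite [leqRHS](bigID (fun l : 'I__ => l < i)) /=.
apply: leq_trans (leq_addr _ _); apply: eq_leq; apply: eq_bigl => l.
by case: (ltnP l i) => [/leq_trans ->|]; rewrite ?andbF.
Qed.

(* How deep the interval [a, b], magnified to [S(3a+1), S(3b+2)], lies inside
   the [i]-th strip; it vanishes unless the interval is inside that strip. The
   factor 3 leaves a margin: a magnified interval whose enlargement by [S] is
   missed by all the cuts has depth at least [S] in some strip. *)
Definition depth (S : nat) z i (a b : nat) :=
  minn (S * (3 * a + 1) - cut z i) (cut z i.+1 - S * (3 * b + 2)).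

Lemma depth_lipschitz S D z z' i a b :
  (forall j, cut z j <= cut z' j + D) -> (forall j, cut z' j <= cut z j + D) ->
  depth S z i a b <= depth S z' i a b + D.
Proof.
move=> h h'; rewrite /depth.
move: (h i.+1) (h' i); move: (S * _) (S * _) (cut z i) (cut z' i) (cut z i.+1) (cut z' i.+1).
by clear; lia.
Qed.

(** A magnified interval has length at least [S]. *)
Lemma depth_thin S z i a b : a <= b -> z i <= S -> depth S z i a b = 0.
Proof.
move=> ab zi; rewrite /depth cutS.
have : S * (3 * a + 1) + S <= S * (3 * b + 2).
  by rewrite -mulnSr leq_mul2l; apply/orP; right; lia.
by move: zi (S * _) (S * _) (cut z i); clear; lia.
Qed.

Lemma depth_disjoint S z (i i' : 'I_k.+1) a b a' b' : i < i' ->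
  0 < depth S z i a b -> 0 < depth S z i' a' b' -> b < a'.
Proof.
rewrite /depth !leq_min !subn_gt0 => ii' /andP[_ h] /andP[h' _].
have : S * (3 * b + 2) < S * (3 * a' + 1).
  by apply: ltn_trans h _; apply: leq_ltn_trans h'; apply: cut_mono.
by rewrite ltn_mul2l => /andP[_]; lia.
Qed.

Lemma depth_ge S z a b : 0 < S -> S * (3 * b.+1) <= \sum_i z i ->
  (forall i : 'I_k, ~~ (a <= cut z i.+1 %/ (S * 3) <= b)) ->
  exists i, S <= depth S z i a b.
Proof.
move=> S0 zb miss.
have S3 : 0 < S * 3 by rewrite muln_gt0 S0.
pose P := [pred i : 'I_k.+1 | (i == 0 :> nat) || (cut z i < S * (3 * a))].
have P0 : P ord0 by rewrite inE.
case: (arg_maxnP (@nat_of_ord _) P0) => i Pi imax.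
exists i; rewrite /depth leq_min; apply/andP; split.
  have : cut z i <= S * (3 * a).
    by move: Pi => /orP[/eqP ->|/ltnW //]; rewrite cut0.
  by rewrite mulnDr muln1; move: (S * _) (cut z i); clear; lia.
have -> : S * (3 * b + 2) = S * (3 * b.+1) - S.
  by rewrite -{3}[S]muln1 -mulnBr; congr (_ * _); lia.
suff : S * (3 * b.+1) <= cut z i.+1.
  have : S <= S * (3 * b.+1) by rewrite leq_pmulr.
  by move: (S * _) (cut _ _); clear; lia.
case: (ltnP i k) => ik; last first.
  have -> : i.+1 = k.+1 by have := ltn_ord i; lia.
  by rewrite cut_last.
have := miss (Ordinal ik); rewrite /= negb_and -!ltnNge => /orP[lt|lt].
  suff /imax : P (Ordinal (ik : i.+1 < k.+1)) by rewrite /= ltnn.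
  rewrite inE /= mulnA.
  by rewrite [ltnRHS]mulnC -ltn_divLR.
by rewrite mulnA [leqLHS]mulnC -leq_divRL.
Qed.
End Strips.

(** * Piercing integer boxes *)

Lemma min_le_average (k : nat) (F : 'I_k.+1 -> nat) :
  k.+1 * F [arg min_(i < ord0) F i] <= \sum_i F i.
Proof.
case: arg_minnP => // i _ h; rewrite -{1}[k.+1]card_ord -sum_nat_const.
by apply: leq_sum => j _; apply: h.
Qed.

Lemma leq_sum_const (I : finType) (F G : I -> nat) d :
  (forall i, F i <= G i + d) -> \sum_i F i <= \sum_i G i + #|I| * d.
Proof.
by move=> h; rewrite -sum_nat_const -big_split; apply: leq_sum => i _; apply: h.
Qed.

Theorem box_piercing (T : finType) (a b a' b' : T -> nat) (m n : nat) :
  n <= m -> (forall t, a t <= b t) -> (forall t, a' t <= b' t) ->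
  (exists (c : 'I_m -> nat) (d : 'I_n -> nat), forall t,
     (exists i, a t <= c i <= b t) \/ (exists j, a' t <= d j <= b' t)) \/
  (exists f : 'I_m.+1 -> T, (forall i i' : 'I_m.+1, i < i' -> b (f i) < a (f i')) /\
     exists h : 'I_n.+1 -> 'I_m.+1,
       forall j j' : 'I_n.+1, j < j' -> b' (f (h j)) < a' (f (h j'))).
Proof.
move=> nm ab ab'.
pose L := ('I_m.+1 + 'I_n.+1)%type.
pose D := #|{: L}|.
(* Within [J] each [w] varies by at most [D]; [E] pays for moving both [W] and [m.+1] times a row
   sum (or [n.+1] times a column sum). [S] makes one missed box outweigh [E * m.+1] and exceeds [D].
   [K] covers all magnified boxes, and [N] leaves width [K] in both directions. *)
pose E := 2 * (m.+1 * (n.+1 * (#|T| * D))).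
pose S := E * m.+1 + D.+1.
pose K := S * (3 * (maxn (\max_t b t) (\max_t b' t)).+1).
pose N := 2 * (K + D).
pose row (z : {ffun L -> 'I_N.+1}) (i : 'I_m.+1) : nat := z (inl i).
pose col (z : {ffun L -> 'I_N.+1}) (j : 'I_n.+1) : nat := z (inr j).
pose w z i j t := minn (depth S (row z) i (a t) (b t)) (depth S (col z) j (a' t) (b' t)).
pose M z i j := \sum_t w z i j t.
pose R z i := \sum_j M z i j.
pose C z j := \sum_i M z i j.
pose W z := \sum_i R z i.
have WC z : W z = \sum_j C z j by rewrite /W exchange_big.
pose colour z : L := if \sum_i row z i < \sum_j col z j
  then inl [arg min_(i < ord0) R z i] else inr [arg min_(j < ord0) C z j].
have [J [J0 JN JI Jnear]] := grid_bullying (inl ord0 : L) colour.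
have [z zJ] := set0Pn _ J0.
have rowN y : y \in J -> \sum_i row y i + \sum_j col y j = N.
  by move=> yJ; rewrite -[RHS](JN _ yJ) big_sumType.
have row_near y y' (A : pred 'I_m.+1) : y \in J -> y' \in J ->
    \sum_(i | A i) row y i <= \sum_(i | A i) row y' i + D.
  move=> yJ y'J; pose A' (l : L) := if l is inl i then A i else false.
  by have := Jnear y y' A' yJ y'J; rewrite !big_sumType /= !big_pred0_eq !addn0.
have col_near y y' (A : pred 'I_n.+1) : y \in J -> y' \in J ->
    \sum_(i | A i) col y i <= \sum_(i | A i) col y' i + D.
  move=> yJ y'J; pose A' (l : L) := if l is inr i then A i else false.
  by have := Jnear y y' A' yJ y'J; rewrite !big_sumType /= !big_pred0_eq !add0n.
(* Were the rows narrower at all points of [J], all colours would be rows, and these would take up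
   nearly all of [N]. So either side is the wider one somewhere in [J], up to ties, and partial sums
   vary by at most [D]. *)
have wide : K <= \sum_i row z i /\ K <= \sum_j col z j.
  have [y yJ yP] : exists2 y, y \in J & \sum_j col y j <= \sum_i row y i.
    apply/exists_inP; apply: contraT; rewrite negb_exists_in => /forall_inP h.
    have := JI z zJ; rewrite leqNgt => /negP[].
    have : \sum_(l in colour @: J) z l <= \sum_i row z i.
      rewrite big_sumType /= [X in _ + X]big1 ?addn0 => [|j]; last first.
        move=> /imsetP[y yJ]; rewrite /colour ifT //.
        by rewrite ltnNge h.
      by rewrite [leqLHS]big_mkcond; apply: leq_sum => i _; case: ifP.
    have := h z zJ; rewrite -ltnNge; move: (rowN z zJ); rewrite /N -/D.
    by move: (\sum_(l in _) _) (\sum_i _) (\sum_i _); clear; lia.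
  have [x xJ xP] : exists2 x, x \in J & \sum_i row x i < \sum_j col x j.
    apply/exists_inP; apply: contraT; rewrite negb_exists_in => /forall_inP h.
    have := JI z zJ; rewrite leqNgt => /negP[].
    have : \sum_(l in colour @: J) z l <= \sum_j col z j.
      rewrite big_sumType /= [X in X + _]big1 ?add0n => [|j]; last first.
        by move=> /imsetP[u uJ]; rewrite /colour (negbTE (h u uJ)).
      by rewrite [leqLHS]big_mkcond; apply: leq_sum => i _; case: ifP.
    have := h z zJ; rewrite -leqNgt; move: (rowN z zJ); rewrite /N -/D.
    by move: (\sum_(l in _) _) (\sum_i _) (\sum_i _); clear; lia.
  have := row_near y z predT yJ zJ; have := col_near x z predT xJ zJ.
  move: yP xP (rowN y yJ) (rowN x xJ); rewrite /N.
  move: (\sum_i row z i) (\sum_j col z j) (\sum_i row x i) (\sum_j col x j).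
  by move: (\sum_i row y i) (\sum_j col y j); clear; lia.
have w_near y y' i j t : y \in J -> y' \in J -> w y i j t <= w y' i j t + D.
  move=> yJ y'J.
  have h1 : depth S (row y) i (a t) (b t) <= depth S (row y') i (a t) (b t) + D.
    by apply: depth_lipschitz => l; apply: row_near.
  have h2 : depth S (col y) j (a' t) (b' t) <= depth S (col y') j (a' t) (b' t) + D.
    by apply: depth_lipschitz => l; apply: col_near.
  move: h1 h2; rewrite /w.
  by move: (depth _ _ _ _ _) (depth _ _ _ _ _) (depth _ _ _ _ _) (depth _ _ _ _ _);
    clear; lia.
have M_near y y' i j : y \in J -> y' \in J -> M y i j <= M y' i j + #|T| * D.
  by move=> yJ y'J; apply: leq_sum_const => t; apply: w_near.
have R_near y y' i : y \in J -> y' \in J -> R y i <= R y' i + n.+1 * (#|T| * D).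
  by move=> yJ y'J; rewrite -{1}[n.+1]card_ord; apply: leq_sum_const => j; apply: M_near.
have C_near y y' j : y \in J -> y' \in J -> C y j <= C y' j + m.+1 * (#|T| * D).
  by move=> yJ y'J; rewrite -{1}[m.+1]card_ord; apply: leq_sum_const => i; apply: M_near.
have W_near y y' : y \in J -> y' \in J -> W y <= W y' + m.+1 * (n.+1 * (#|T| * D)).
  by move=> yJ y'J; rewrite -{1}[m.+1]card_ord; apply: leq_sum_const => i; apply: R_near.
have small l : l \notin colour @: J -> z l <= S.
  move=> lI; have := JI z zJ; rewrite -{1}(JN z zJ) -/D (bigID (mem (colour @: J))) /=.
  rewrite ltn_add2l (bigD1 l) //= => /(leq_ltn_trans (leq_addr _ _)).
  by rewrite /S; move: (E * _); clear; lia.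
(* If row [i] is the colour of some [y] in [J], it is at most average at [y], and moving to [z]
   costs [E]. Otherwise its strip is too thin to hold a box. *)
have R_le i : m.+1 * R z i <= W z + E.
  case: (boolP (inl i \in colour @: J)) => [/imsetP[y yJ]|/small zi].
    rewrite /colour; case: ifP => // _ [iE].
    have := min_le_average (R y); rewrite -iE -/(W y) => Ry.
    have := W_near y z yJ zJ; have := R_near z y i zJ yJ; rewrite -(leq_pmul2l (ltn0Sn m)) mulnDr.
    by move: Ry; rewrite /E; move: (m.+1 * R z i) (m.+1 * R y i) (m.+1 * (n.+1 * _)); clear; lia.
  suff -> : R z i = 0 by rewrite muln0.
  apply: big1 => j _; apply: big1 => t _; apply/eqP.
  by rewrite /w (depth_thin (ab t)) // min0n.
have C_le j : n.+1 * C z j <= W z + E.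
  case: (boolP (inr j \in colour @: J)) => [/imsetP[y yJ]|/small zi].
    rewrite /colour; case: ifP => // _ [iE].
    have := min_le_average (C y); rewrite -iE -WC => Ry.
    have := W_near y z yJ zJ; have := C_near z y j zJ yJ.
    rewrite -(leq_pmul2l (ltn0Sn n)) mulnDr [n.+1 * (m.+1 * _)]mulnCA.
    by move: Ry; rewrite /E; move: (n.+1 * C z j) (n.+1 * C y j) (m.+1 * (n.+1 * _)); clear; lia.
  suff -> : C z j = 0 by rewrite muln0.
  apply: big1 => i _; apply: big1 => t _; apply/eqP.
  by rewrite /w (depth_thin (ab' t)) // minn0.
(* Only the inner cuts count; the division undoes the magnification. *)
pose c (i : 'I_m) := cut (row z) i.+1 %/ (S * 3).
pose d (j : 'I_n) := cut (col z) j.+1 %/ (S * 3).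
case: (boolP [forall t, [exists i, a t <= c i <= b t] || [exists j, a' t <= d j <= b' t]]).
  move=> /forallP h; left; exists c, d => t.
  by case/orP: (h t) => /existsP ?; [left|right].
rewrite negb_forall => /existsP[t]; rewrite negb_or !negb_exists => /andP[/forallP hc /forallP hd].
right.
have S0 : 0 < S by rewrite /S addnS.
have Kt k : k <= maxn (\max_t b t) (\max_t b' t) -> S * (3 * k.+1) <= K.
  by move=> h; rewrite /K !leq_mul2l ltnS h !orbT.
have [i0 hi0] : exists i, S <= depth S (row z) i (a t) (b t).
  apply: depth_ge => //; apply: leq_trans wide.1; apply: Kt.
  by rewrite leq_max leq_bigmax.
have [j0 hj0] : exists j, S <= depth S (col z) j (a' t) (b' t).
  apply: depth_ge => //; apply: leq_trans wide.2; apply: Kt.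
  by rewrite leq_max leq_bigmax ?orbT.
have EW : E * m.+1 < W z.
  apply: (@leq_trans S); first by rewrite /S addnS ltnS leq_addr.
  rewrite /W (bigD1 i0) //= /R (bigD1 j0) //= /M (bigD1 t) //= /w.
  rewrite -!addnA; apply: leq_trans (leq_addr _ _).
  by rewrite leq_min hi0 hj0.
have [rows [g g_inj gM]] := balanced_matching nm (erefl (W z)) EW R_le C_le.
have w_pos i j x : 0 < w z i j x ->
    0 < depth S (row z) i (a x) (b x) /\ 0 < depth S (col z) j (a' x) (b' x).
  by move=> wx; apply/andP; rewrite -leq_min.
have M_pos i j : 0 < M z i j -> exists t, 0 < w z i j t.
  move=> Mij; apply/existsP; apply: contraT; rewrite negb_exists => /forallP h.
  by move: Mij; rewrite /M big1 // => x _; apply/eqP; rewrite eqn0Ngt.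
(* In a row matched with a column the box must come from that very column. *)
have fP i : exists t, exists j, 0 < w z i j t /\ forall j', i = g j' -> j = j'.
  case: (pickP (fun j => g j == i)) => [j /eqP <-|h].
    by have [x wx] := M_pos _ _ (gM j); exists x, j; split=> // j' /g_inj.
  have [j Mij] := rows i; have [x wx] := M_pos _ _ Mij; exists x, j; split=> // j' e.
  by have := h j'; rewrite e eqxx.
have [f fw] := fin_all_exists fP.
exists f; split=> [i i' ii'|].
  have [j [/w_pos[h _] _]] := fw i; have [j' [/w_pos[h' _] _]] := fw i'.
  exact: depth_disjoint ii' h h'.
exists g => j j' jj'.
have [k [/w_pos[_ h] /(_ j erefl) kj]] := fw (g j).
have [k' [/w_pos[_ h'] /(_ j' erefl) kj']] := fw (g j').
rewrite kj in h; rewrite kj' in h'.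
exact: depth_disjoint jj' h h'.
Qed.

(** * Connected sets *)

Require Import Defs.
From mathcomp Require Import all_boot all_order all_algebra.
From mathcomp Require Import all_classical all_reals all_analysis.
Import Order.TTheory GRing.Theory Num.Theory.
Import numFieldNormedType.Exports.
Local Open Scope classical_set_scope.
Local Open Scope card_scope.
Local Open Scope ring_scope.

(** The representatives are sorted, and [a t], [b t] are the first and last indices of those in
    [P t]; convexity covers the indices between. Two intersecting intervals share a representative,
    so their index ranges overlap. *)
Lemma discretize_intervals (R : realType) (T : finType) (P : T -> set R) :
  (forall t, is_interval (P t)) -> (forall t, P t !=set0) ->
  exists (a b : T -> nat) (x : nat -> R), [/\ forall t, (a t <= b t)%N,
    forall t k, (a t <= k <= b t)%N -> P t (x k) &
    forall t t', (b t < a t')%N -> P t `&` P t' = set0].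
Proof.
move=> itv nonempty.
have /choice[p pP] (u : T * T) :
    exists y, P u.1 y /\ (P u.1 `&` P u.2 !=set0 -> P u.2 y).
  case: (pselect (P u.1 `&` P u.2 !=set0)) => [[y [y1 y2]]|h]; first by exists y.
  by have [y ?] := nonempty u.1; exists y.
pose s := sort <=%O [seq p u | u <- enum {: T * T}].
have ps u : p u \in s by rewrite mem_sort map_f // mem_enum.
have s_le : {in [pred n | (n < size s)%N] &,
    {homo nth 0 s : i j / (i <= j)%N >-> i <= j}}.
  exact/(sorted_leq_nth le_trans le_refl)/(sort_sorted le_total).
(* The bound on [k] keeps the default value [0] of [nth] from counting as a representative. *)
pose hit t k := (k < size s)%N && `[< P t (nth 0 s k) >].
have hitP t u : P t (p u) -> hit t (index (p u) s).
  by move=> h; rewrite /hit index_mem ps nth_index //; apply/asboolP.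
have /choice[ab abP] t : exists ab : nat * nat, [/\ hit t ab.1, hit t ab.2 &
    forall k, hit t k -> (ab.1 <= k <= ab.2)%N].
  have ex : exists k, hit t k by exists (index (p (t, t)) s); apply/hitP/(pP (t, t)).1.
  have ub k : hit t k -> (k <= size s)%N by case/andP => /ltnW.
  case: (ex_minnP ex) => a ha amin; case: (ex_maxnP ex ub) => b hb bmax.
  by exists (a, b); split=> //= k hk; rewrite amin ?bmax.
exists (fun t => (ab t).1), (fun t => (ab t).2), (nth 0 s); split.
- by move=> t; have [_ /[swap]/[apply]/andP[]] := abP t.
- move=> t k /andP[ak kb]; have [/andP[sa /asboolP ha] /andP[sb /asboolP hb] _] := abP t.
  have sk := leq_ltn_trans kb sb.
  by apply: (itv _ _ _ ha hb); rewrite !s_le ?inE.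
move=> t t' ba; apply/eqP; apply: contraTT ba => /set0P tt'; rewrite -leqNgt.
have [h1 h2] := pP (t, t'); have [_ _ /(_ _ (hitP _ _ h1)) /andP[_ ub]] := abP t.
have [_ _ /(_ _ (hitP _ _ (h2 tt'))) /andP[lb _]] := abP t'.
exact: leq_trans lb ub.
Qed.

(** Cut positions may coincide, while exactly [k] distinct lines are required. The padding values
    exceed every entry of [s]. *)
Lemma uniq_extension (R : realType) (k : nat) (s : seq R) :
  (size s <= k)%N -> exists s' : seq R, [/\ uniq s', size s' = k & {subset s <= s'}].
Proof.
move=> sk; pose new i : R := 1 + \sum_(x <- s) `|x| + i%:R.
have new_inj : injective new by move=> i j /addrI /eqP; rewrite eqr_nat => /eqP.
have newP i : new i \notin s.
  apply/negP => h; have : new i <= `|new i| by apply: ler_norm.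
  have : `|new i| <= \sum_(x <- s) `|x|.
    by rewrite (big_rem _ h) /= lerDl sumr_ge0.
  move=> /[swap] /le_trans /[apply]; rewrite /new -addrA addrCA gerDl leNgt.
  by rewrite ltr_pwDl.
exists (undup s ++ [seq new i | i <- iota 0 (k - size (undup s))]); split.
- rewrite cat_uniq undup_uniq map_inj_uniq // iota_uniq andbT /=.
  by apply/hasPn => _ /mapP[i _ ->]; rewrite mem_undup newP.
- by rewrite size_cat size_map size_iota subnKC // (leq_trans (size_undup s)).
- by move=> x xs; rewrite mem_cat mem_undup xs.
Qed.

(** * Lines of a fixed direction as level sets of a projection *)

Section Direction.
Variables (R : realType) (pi : R * R -> R) (sec : R -> R * R)
  (dir : set (R * R) -> Prop).
Hypothesis secK : cancel sec pi.
Hypothesis dir_level : forall y, dir (pi @^-1` [set y]).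
Hypothesis dir_const : forall l p q, dir l -> l p -> l q -> pi p = pi q.

Lemma level_lines (k : nat) (c : 'I_k -> R) :
  exists L : set (set (R * R)), (L #= `I_k /\ (forall l, L l -> dir l)) /\
    forall i, L (pi @^-1` [set c i]).
Proof.
have [s [us sk sub]] : exists s : seq R,
    [/\ uniq s, size s = k & {subset [seq c i | i <- enum 'I_k] <= s}].
  by apply: uniq_extension; rewrite size_map size_enum_ord.
exists [set pi @^-1` [set nth 0 s i] | i in `I_k]; split; [split|].
- apply: inj_card_eq => i j; rewrite !inE /= => ik jk ij; apply/eqP.
  rewrite -(nth_uniq 0 _ _ us) ?sk //; apply/eqP.
  have : (pi @^-1` [set nth 0 s j]) (sec (nth 0 s i)) by rewrite -ij /= secK.
  by rewrite /= secK.
- by move=> _ [i _ <-].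
move=> i; have ci : c i \in s by apply: sub; rewrite map_f // mem_enum.
by exists (index (c i) s); rewrite /= ?nth_index // -sk index_mem.
Qed.

(** Two of the sets meet the same line, on which [pi] is constant. *)
Lemma lines_pigeonhole (k : nat) (L : set (set (R * R))) (A : 'I_k.+1 -> set (R * R)) :
  L #= `I_k -> (forall l, L l -> dir l) ->
  (forall i, exists2 l, L l & A i `&` l !=set0) ->
  exists i i' : 'I_k.+1, (i < i')%N /\ (pi @` A i) `&` (pi @` A i') !=set0.
Proof.
move=> /card_set_bijP[f [fL f_inj _]] Ldir cut.
have /choice[l lP] i : exists l, L l /\ A i `&` l !=set0.
  by have [l Ll Al] := cut i; exists l.
have lk i : (f (l i) < k)%N by apply: fL; have [] := lP i.
have /injectivePn[i [i' ii' e]] : ~~ injectiveb (fun i => Ordinal (lk i)).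
  by apply/negP => /injectiveP /leq_card; rewrite !card_ord ltnn.
have lii : l i = l i'.
  by apply: f_inj; [rewrite inE; have [] := lP i|rewrite inE; have [] := lP i'|case: e].
have meet : (pi @` A i) `&` (pi @` A i') !=set0.
  have [Li [p [Ap lp]]] := lP i; have [_ [q [Aq lq]]] := lP i'.
  exists (pi p); split; [by exists p | exists q => //].
  by rewrite -lii in lq; apply: dir_const lq lp; apply: Ldir.
move: ii'; rewrite neq_ltn => /orP[h|h]; first by exists i, i'.
by exists i', i; rewrite setIC.
Qed.

End Direction.

Lemma horizontal_const (R : realType) (l : set (R * R)) p q :
  horizontal l -> l p -> l q -> p.2 = q.2.
Proof.
move=> [p0 [q0 [v [v0 -> ax]]]].
have on t : (q0 + (t * v.1, t * v.2)).2 = 0.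
  by have : x_axis (q0 + (t * v.1, t * v.2)) by rewrite ax; exists t.
(* Parameters [0] and [1] give two points of the axis differing by [v]. *)
have v2 : v.2 = 0 by have := on 1; have := on 0; rewrite /= mul0r mul1r addr0 => ->; rewrite add0r.
by move=> [t _ <-] [t' _ <-]; rewrite /= v2 !mulr0.
Qed.

Lemma vertical_const (R : realType) (l : set (R * R)) p q :
  vertical l -> l p -> l q -> p.1 = q.1.
Proof.
move=> [p0 [q0 [v [v0 -> ax]]]].
have on t : (q0 + (t * v.1, t * v.2)).1 = 0.
  by have : y_axis (q0 + (t * v.1, t * v.2)) by rewrite ax; exists t.
have v2 : v.1 = 0 by have := on 1; have := on 0; rewrite /= mul0r mul1r addr0 => ->; rewrite add0r.
by move=> [t _ <-] [t' _ <-]; rewrite /= v2 !mulr0.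
Qed.

Lemma horizontal_level (R : realType) (y : R) :
  horizontal ((snd : R * R -> R) @^-1` [set y]).
Proof.
have level z : (snd : R * R -> R) @^-1` [set z] = line_through (0, z) (1, 0).
  apply/seteqP; split=> [[p1 p2] /= ->|_ [t _ <-]] /=.
    by exists p1 => //; rewrite /= mulr1 mulr0; congr (_, _); rewrite /= ?add0r ?addr0.
  by rewrite mulr0 addr0.
exists (0, y), (0, 0), (1, 0); split; [|exact: level|exact: level].
by rewrite xpair_eqE oner_eq0.
Qed.

Lemma vertical_level (R : realType) (x : R) :
  vertical ((fst : R * R -> R) @^-1` [set x]).
Proof.
have level z : (fst : R * R -> R) @^-1` [set z] = line_through (z, 0) (0, 1).
  apply/seteqP; split=> [[p1 p2] /= ->|_ [t _ <-]] /=.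
    by exists p2 => //; rewrite /= mulr1 mulr0; congr (_, _); rewrite /= ?add0r ?addr0.
  by rewrite mulr0 addr0.
exists (x, 0), (0, 0), (0, 1); split; [|exact: level|exact: level].
by rewrite xpair_eqE oner_eq0 andbF.
Qed.

(** * Cutting connected sets *)

Lemma image_is_interval (R : realType) (pi : R * R -> R) (A : set (R * R)) :
  continuous pi -> connected A -> is_interval (pi @` A).
Proof.
move=> cpi cA; apply/connected_intervalP/connected_continuous_connected => //.
exact: continuous_subspaceT.
Qed.

Theorem corollary5 (R : realType) (F : set (set (R * R))) (n m : nat)
    (F_finite : finite_set F)
    (F_connected : forall A, F A -> connected A)
    (F_bounded : forall A, F A -> bounded_set A)
    (F_open_or_compact :
      (forall A, F A -> open A) \/ (forall A, F A -> compact A))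
    (n_gt0 : (0 < n)%N) (m_gt0 : (0 < m)%N) (le_nm : (n <= m)%N)
    (F_small : forall G : set (set (R * R)), G `<=` F -> G #<= `I_m.+1 ->
      (exists2 H, horizontal_lines m H & cuts H G) \/
      (exists2 V, vertical_lines n V & cuts V G)) :
  exists H V : set (set (R * R)),
    [/\ horizontal_lines m H, vertical_lines n V & cuts (H `|` V) F].
Proof.
have [s Fs] := (finite_seqP F).1 F_finite.
pose A (t : 'I_(size s)) := nth set0 s t.
have FA t : F (A t) by rewrite Fs /= mem_nth.
have small k (f : 'I_k.+1 -> 'I_(size s)) : (k <= m)%N ->
    (exists2 H, horizontal_lines m H & cuts H [set A (f i) | i in [set: 'I_k.+1]]) \/
    (exists2 V, vertical_lines n V & cuts V [set A (f i) | i in [set: 'I_k.+1]]).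
  move=> km; apply: F_small => [_ [i _ <-] //|].
  apply: card_le_trans (card_image_le _ _) _.
  by rewrite -(card_le_eql card_II) card_le_II.
(* The one-member subfamily can be cut, and no line meets the empty set. *)
have A0 t : A t !=set0.
  suff [L cL] : exists L, cuts L [set A t | _ in [set: 'I_1]].
    by have [|l _ [p [Ap _]]] := cL (A t); [exists ord0 | exists p].
  by have [[L _ cL]|[L _ cL]] := small 0 (fun=> t) isT; exists L.
have cfst : continuous (fst : R * R -> R) by move=> p; apply: cvg_fst.
have csnd : continuous (snd : R * R -> R) by move=> p; apply: cvg_snd.
have [a [b [x [ab xP disj]]]] := discretize_intervals
  (fun t => image_is_interval csnd (F_connected _ (FA t)))
  (fun t => image_nonempty _ (A0 t)).
have [a' [b' [x' [ab' xP' disj']]]] := discretize_intervals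
  (fun t => image_is_interval cfst (F_connected _ (FA t)))
  (fun t => image_nonempty _ (A0 t)).
have [[c [d cd]]|[f [fdisj [h hdisj]]]] := box_piercing le_nm ab ab'.
  have [H [Hlines Hc]] := level_lines (fun y => erefl : snd (0, y) = y)
    (@horizontal_level R) (fun i => x (c i)).
  have [V [Vlines Vd]] := level_lines (fun y => erefl : fst (y, 0) = y)
    (@vertical_level R) (fun j => x' (d j)).
  exists H, V; split=> // B; rewrite Fs /= => Bs.
  have sB : (index B s < size s)%N by rewrite index_mem.
  have BA : B = A (Ordinal sB) by rewrite /A nth_index.
  have [[i /xP[p Ap px]]|[j /xP'[p Ap px]]] := cd (Ordinal sB).
    by exists (snd @^-1` [set x (c i)]); [left | exists p; rewrite BA].
  by exists (fst @^-1` [set x' (d j)]); [right | exists p; rewrite BA].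
(* The [m.+1] sets have pairwise disjoint vertical projections, and [n.+1] of them have pairwise
   disjoint horizontal ones, so either kind of cut contradicts the pigeonhole principle. *)
have [[H [Hm Hh] cH]|[V [Vn Vv] cV]] := small m f (leqnn m).
  have [i [i' [ii']]] := lines_pigeonhole (@horizontal_const R) Hm Hh
    (fun i => cH _ (ex_intro2 _ _ i I erefl)).
  by rewrite disj ?fdisj // => -[].
have [i [i' [ii']]] := lines_pigeonhole (@vertical_const R) Vn Vv
  (fun i => cV _ (ex_intro2 _ _ (h i) I erefl)).
by rewrite disj' ?hdisj // => -[].
Qed.
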